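(* There is a universal constant $C>0$ such that for every $1<p<\infty$, with $q=p/(p-1)$, there is a constant $\bar{C}_p$ depending only on $p$ and satisfying $$\bar{C}_p \le 4\,p^{1/p}q^{1/q}\left(1+\max\{(p-1)^{-1/p},(q-1)^{-1/q}\}\right)\le C\cdot\max\left\{\frac{1}{p-1},\frac{1}{q-1}\right\},$$ for which the following holds. For every integer $N\ge 1$ and all $W_1,\ldots,W_N>0$ there exists a linear operator $T:L^p(E)\to L^p(E)$ whose operator norm is at most $\bar{C}_p$ and which has the following properties: (1) There is a linear operator $\tilde T:\mathbb{R}^V\to\mathbb{R}^V$ such that for all $f:E\to\mathbb{R}$ and $x\in E$, $$Tf(x)=\tilde T\tilde f(x)-\tilde T\tilde f(\pi_{d(x)-1}x).$$ (2) $\tilde T$ is equivariant with respect to the symmetries of the tree, and $\tilde T(1)\equiv1$, i.e. $\tilde T$ maps the constant function $1$ to itself. (3) $(\tilde Tg)|_{\partial V}=g|_{\partial V}$ for every $g:V\to\mathbb{R}$. (4) For every $g:V\to\mathbb{R}$, the function $\tilde Tg$ is determined by $g|_{\partial V}$ (i.e. if $g_1|_{\partial V}=g_2|_{\partial V}$ then $\tilde Tg_1=\tilde Tg_2$).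
   Context: The full binary tree of height $N$ has vertex set $V=\bigcup_{k=0}^N\{0,1\}^k$ (binary strings of length at most $N$), root $\emptyset$ (the empty string), and leaves $\partial V=\{0,1\}^N$. For $x\in\{0,1\}^k$ the depth is $d(x)=k$, and for $\ell\le k$, $\pi_\ell x=\pi_\ell(x)$ is the prefix of $x$ of length $\ell$; the parent of $x\ne\emptyset$ is $\pi_{d(x)-1}(x)$. The set of edges is identified with $E=V\setminus\{\emptyset\}=\bigcup_{k=1}^N\{0,1\}^k$ (the string $e$ representing the edge joining $e$ to its parent). A symmetry of the tree is a bijection $\sigma:V\to V$ preserving depth and the parenthood relation; $\tilde T$ is equivariant if $\tilde T(g\circ\sigma)=(\tilde Tg)\circ\sigma$ for every $g\in\mathbb{R}^V$ and every symmetry $\sigma$. Given $W_1,\ldots,W_N>0$, $L^p(E)$ is the space of functions $f:E\to\mathbb{R}$ with norm $$\|f\|_{L^p(E)}=\left(\sum_{k=1}^N W_k\sum_{x\in\{0,1\}^k}|f(x)|^p\right)^{1/p}.$$ For $f:E\to\mathbb{R}$, the function $\tilde f:V\to\mathbb{R}$ is defined by $\tilde f(\emptyset)=0$ and $\tilde f(x)=\sum_{i=1}^{d(x)}f(\pi_i x)$ for $x\neq\emptyset$. *)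

(* Defs.v *)
From mathcomp Require Import all_boot all_order all_fingroup all_algebra.
From mathcomp Require Import all_classical all_reals all_analysis.

Set Implicit Arguments.
Unset Strict Implicit.
Unset Printing Implicit Defensive.

Import Order.TTheory GRing.Theory Num.Theory.

Local Open Scope ring_scope.

Definition vertex (N : nat) := N.-bseq bool.

Definition root_vertex (N : nat) : vertex N := [bseq].

Definition depth (N : nat) (x : vertex N) : nat := size x.

Definition leaf (N : nat) (x : vertex N) : bool := depth x == N.

(* The prefix of length [l]; it is [x] itself when [l] exceeds the depth. *)
Definition prefix_of (N l : nat) (x : vertex N) : vertex N := [bseq of take l x].

(* [parent] is total, with the junk value [root_vertex] at the root;
   [is_parent] is the parenthood relation. *)
Definition parent (N : nat) (x : vertex N) : vertex N :=
  prefix_of (depth x).-1 x.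

Definition is_parent (N : nat) (y x : vertex N) : bool :=
  (x != root_vertex N) && (y == parent x).

(* A string stands for the edge joining it to its parent. *)
Definition edge (N : nat) := {x : vertex N | x != root_vertex N}.

Lemma prefix_of_neq_root (N : nat) (x : vertex N) (i : 'I_(depth x)) :
  prefix_of i.+1 x != root_vertex N.
Proof.
by apply/eqP => /(congr1 (@depth N)); rewrite /depth /= size_takel.
Qed.

Definition prefix_edge (N : nat) (x : vertex N) (i : 'I_(depth x)) : edge N :=
  exist _ (prefix_of i.+1 x) (prefix_of_neq_root i).

(* At the root the sum is empty, so the value there is 0. *)
Definition tilde (R : realType) (N : nat) (f : {ffun edge N -> R}) :
    {ffun vertex N -> R} :=
  [ffun x => \sum_(i < depth x) f (prefix_edge i)].

Definition symmetry (N : nat) (s : {perm vertex N}) : Prop :=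
  (forall x, depth (s x) = depth x) /\
  (forall x y, is_parent (s y) (s x) = is_parent y x).

Definition equivariant (R : realType) (N : nat)
    (S : {ffun vertex N -> R} -> {ffun vertex N -> R}) : Prop :=
  forall (g : {ffun vertex N -> R}) (s : {perm vertex N}), symmetry s ->
    S [ffun x => g (s x)] = [ffun x => S g (s x)].

(* The weights are indexed from 0: [W k] is the weight of depth [k.+1]. *)
Definition lp_norm (R : realType) (N : nat) (p : R) (W : 'I_N -> R)
    (f : {ffun edge N -> R}) : R :=
  (\sum_(k < N) W k * \sum_(x : edge N | depth (val x) == k.+1) `|f x| `^ p) `^ p^-1.

(* The supremum is taken in the extended reals, so that an upper bound on it
   is meaningful without knowing beforehand that it is finite. *)
Definition lp_op_norm (R : realType) (N : nat) (p : R) (W : 'I_N -> R)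
    (T : {ffun edge N -> R} -> {ffun edge N -> R}) : \bar R :=
  ereal_sup [set (lp_norm p W (T f))%:E | f in [set f | lp_norm p W f <= 1]].

(* Main.v *)
Require Import Defs.
From HB Require Import structures.
From mathcomp Require Import all_boot all_order all_fingroup all_algebra.
From mathcomp Require Import all_classical all_reals all_analysis.
From mathcomp Require Import zify ring lra.

Set Implicit Arguments.
Unset Strict Implicit.
Unset Printing Implicit Defensive.

Import Order.TTheory GRing.Theory Num.Theory.

Local Open Scope ring_scope.

(* Let [A_l g] be the mean of [g] over the leaves that share the prefix of
   length [l], [w k = W k * 2 ^ (k+1)] the total weight of the edges of depth
   [k+1], [v = w^(1-q)] and [r k] the tail sum of [v] from [k]. The extension [Tt] is harmonic for
   the radial walk with tail function [r], so that on an edge of depth [k+1]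
   the operator [T] is [v k * sum_(l <= k) (A_(l+1) - A_l)(tilde f) / r l].
   At level [j] of [f] the sum stops at [min k j] because [A_l] fixes functions
   of the first [l] letters, and Abel summation, the [A_l] being L^p
   contractions and [1 / r] nondecreasing, bounds it by [2 / r (min k j)] times
   the norm of that level; taking absolute values termwise would lose an
   unbounded factor. This leaves a bilinear form on the levels with kernel
   [1 / r (min k j)], the sum of the Hardy operator of [v] and its adjoint,
   whose norms are [q] and [p]. Hence [T] has norm at most [2 (p + q)], and
   [p^(1/p) q^(1/q) (p-1)^(-1/p) = q] compares this with the stated constant. *)

(** * Hardy's inequality *)

Lemma conjugate_ge1 (R : realType) (p q : R) :
  0 < p -> 0 < q -> p^-1 + q^-1 = 1 -> 1 < p.
Proof.
move=> p0 q0 pq; rewrite -invf_lt1// -pq ltrDl invr_gt0 //.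
Qed.

Lemma conjugate_mul (R : realType) (p q : R) :
  0 < p -> 0 < q -> p^-1 + q^-1 = 1 -> p * q = p + q.
Proof.
move=> p0 q0 pq; rewrite -[LHS]mulr1 -pq.
by field; rewrite !gt_eqF.
Qed.

(** Conjugacy amounts to [(p - 1) * q = p]. *)
Lemma conjugate_powRB1 (R : realType) (p q a : R) :
  0 < p -> 0 < q -> p^-1 + q^-1 = 1 -> (a `^ (p - 1)) `^ q = a `^ p.
Proof.
move=> p0 q0 pq; rewrite -powRrM; congr (_ `^ _).
by rewrite mulrBl mul1r (conjugate_mul p0 q0 pq) addrK.
Qed.

Lemma powR_invK (R : realType) (p a : R) : 0 < p -> 0 <= a ->
  (a `^ p^-1) `^ p = a.
Proof. by move=> p0 a0; rewrite -powRrM mulVf ?gt_eqF// powRr1. Qed.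

(** If one norm is zero, every term vanishes; otherwise Young's inequality applies termwise once [x]
    and [y] are divided by their norms. *)
Lemma hoelder_sum (R : realType) (I : finType) (p q : R) (a x y : I -> R) :
  0 < p -> 0 < q -> p^-1 + q^-1 = 1 ->
  (forall i, 0 <= a i) -> (forall i, 0 <= x i) -> (forall i, 0 <= y i) ->
  \sum_i a i * (x i * y i) <=
  (\sum_i a i * x i `^ p) `^ p^-1 * (\sum_i a i * y i `^ q) `^ q^-1.
Proof.
move=> p0 q0 pq a0 x0 y0.
set X := \sum_i a i * x i `^ p; set Y := \sum_i a i * y i `^ q.
have axp i : 0 <= a i * x i `^ p by rewrite mulr_ge0 ?powR_ge0.
have ayq i : 0 <= a i * y i `^ q by rewrite mulr_ge0 ?powR_ge0.
have X0 : 0 <= X by apply: sumr_ge0.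
have Y0 : 0 <= Y by apply: sumr_ge0.
have [XE|Xn0] := eqVneq X 0.
  rewrite big1 ?mulr_ge0 ?powR_ge0// => i _.
  have /(_ i isT) /eqP := psumr_eq0P (fun i _ => axp i) XE.
  rewrite mulf_eq0 powR_eq0 => /orP[/eqP->|/andP[/eqP-> _]]; first by rewrite mul0r.
  by rewrite mul0r mulr0.
have [YE|Yn0] := eqVneq Y 0.
  rewrite big1 ?mulr_ge0 ?powR_ge0// => i _.
  have /(_ i isT) /eqP := psumr_eq0P (fun i _ => ayq i) YE.
  rewrite mulf_eq0 powR_eq0 => /orP[/eqP->|/andP[/eqP-> _]]; first by rewrite mul0r.
  by rewrite !mulr0.
have Xp : 0 < X by rewrite lt_neqAle eq_sym Xn0.
have Yp : 0 < Y by rewrite lt_neqAle eq_sym Yn0.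
set s := X `^ p^-1; set t := Y `^ q^-1.
have s0 : 0 < s by apply: powR_gt0.
have t0 : 0 < t by apply: powR_gt0.
have sX : s `^ p = X by rewrite powR_invK.
have tY : t `^ q = Y by rewrite powR_invK.
suff H i : a i * (x i * y i) <=
    s * t * ((a i * x i `^ p) * (X^-1 / p) + (a i * y i `^ q) * (Y^-1 / q)).
  apply: (le_trans (ler_sum _ (fun i _ => H i))).
  rewrite -mulr_sumr big_split/= -!mulr_suml -/X -/Y.
  by rewrite !mulrA !divff// !mul1r pq mulr1.
clearbody s t; clearbody X Y; clear axp ayq.
have := @conjugate_powR R (x i / s) (y i / t) p q
  (divr_ge0 (x0 i) (ltW s0)) (divr_ge0 (y0 i) (ltW t0)) p0 q0 pq.
have powRV u r : 0 < u -> u^-1 `^ r = (u `^ r)^-1.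
  by move=> u0; rewrite -[u^-1]powR_inv1 ?ltW// -powRrM mulN1r powRN.
rewrite !powRM ?invr_ge0 ?(ltW s0) ?(ltW t0)// !powRV// sX tY => H.
have {}H := ler_wpM2l (mulr_ge0 (ltW s0) (ltW t0)) (ler_wpM2l (a0 i) H).
apply: le_trans (le_trans _ H) _; rewrite le_eqVlt; apply/orP; left; apply/eqP.
  by field; rewrite !gt_eqF.
by field; rewrite !gt_eqF.
Qed.

(** Division by [X ^ (1/q)], as [1 - 1/q = 1/p]: a smaller power of the same sum on the right is
    absorbed. *)
Lemma powR_absorb (R : realType) (p q X B : R) :
  0 < p -> 0 < q -> p^-1 + q^-1 = 1 -> 0 <= X -> 0 <= B ->
  X <= B * X `^ q^-1 -> X `^ p^-1 <= B.
Proof.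
move=> p0 q0 pq X0 B0 H.
have [->|Xn0] := eqVneq X 0; first by rewrite powR0 ?invr_eq0 ?gt_eqF.
have Xp : 0 < X by rewrite lt_neqAle eq_sym Xn0.
rewrite -(ler_pM2r (powR_gt0 q^-1 Xp)); apply: le_trans H.
by rewrite -powRD ?pq ?oner_eq0// powRr1.
Qed.

(* Elliott's step: Young's inequality applied to [A' * A `^ (p - 1)]. *)
Lemma hardy_step (R : realType) (p q v b r A A' : R) :
  0 < p -> 0 < q -> p^-1 + q^-1 = 1 -> 0 <= r -> 0 <= A -> 0 <= A' ->
  (r + v) * A = v * b + r * A' ->
  v * A `^ p <= q * (v * (b * A `^ (p - 1)))
                + (q - 1) * (r * A' `^ p - (r + v) * A `^ p).
Proof.
move=> p0 q0 pq r0 A0 A'0 H.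
have := conjugate_powR A'0 (powR_ge0 A (p - 1)) p0 q0 pq.
rewrite (conjugate_powRB1 _ p0 q0 pq).
have <- := mulr_powRB1 A0 p0.
set Q := A `^ (p - 1); set P' := A' `^ p => Y.
have qp : q / p = q - 1.
  by rewrite -[p^-1](addrK q^-1) pq mulrBr mulr1 divff ?gt_eqF.
have {}Y : q * (A' * Q) <= (q - 1) * P' + A * Q.
  have := ler_wpM2l (ltW q0) Y; rewrite -qp mulrDr [q * (_ / q)]mulrC divfK ?gt_eqF//.
  by rewrite [q * (P' / p)]mulrCA [P' * (q / p)]mulrC.
have -> : v * (b * Q) = ((r + v) * A - r * A') * Q by rewrite H; ring.
have := ler_wpM2l r0 Y.
by lra.
Qed.

(** The bounds of [hardy_step] telescope, Hölder's inequality brings back a power of the left-hand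
    sum, and [powR_absorb] removes it. *)
Lemma hardy (R : realType) (p q : R) (N : nat) (v b : nat -> R) :
  0 < p -> 0 < q -> p^-1 + q^-1 = 1 ->
  (forall k, 0 < v k) -> (forall k, 0 <= b k) ->
  (\sum_(k < N) v k * ((\sum_(k <= j < N) v j * b j)
                       / \sum_(k <= j < N) v j) `^ p) `^ p^-1
  <= q * (\sum_(k < N) v k * b k `^ p) `^ p^-1.
Proof.
move=> p0 q0 pq v0 b0.
pose r k := \sum_(k <= j < N) v j.
pose s k := \sum_(k <= j < N) v j * b j.
pose A k := s k / r k.
have r0 k : 0 <= r k by apply: sumr_ge0 => i _; exact: ltW.
have s0 k : 0 <= s k by apply: sumr_ge0 => i _; rewrite mulr_ge0// ltW.
have A0 k : 0 <= A k by rewrite divr_ge0.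
have rS k : (k < N)%N -> r k = r k.+1 + v k.
  by move=> kN; rewrite /r big_ltn// addrC.
have sS k : (k < N)%N -> s k = v k * b k + s k.+1.
  by move=> kN; rewrite /s big_ltn.
have rp k : (k < N)%N -> 0 < r k by move=> kN; rewrite rS// ltr_wpDl.
(* At [k = N] both tails are empty and the identity reads [0 = 0]. *)
have rA k : (k <= N)%N -> r k * A k = s k.
  rewrite leq_eqVlt => /orP[/eqP->|kN]; last by rewrite mulrC divfK// gt_eqF ?rp.
  by rewrite /r /s !big_geq// mul0r.
have step k : (k < N)%N -> v k * A k `^ p <=
    q * (v k * (b k * A k `^ (p - 1)))
    + (q - 1) * (r k.+1 * A k.+1 `^ p - r k * A k `^ p).
  move=> kN; rewrite (rS k kN); apply: hardy_step => //.
  by rewrite -rS// !rA ?(ltnW kN)// sS.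
have q1 : 1 < q by apply: (@conjugate_ge1 _ q p); rewrite // addrC.
have X0 : 0 <= \sum_(k < N) v k * A k `^ p.
  by apply: sumr_ge0 => k _; rewrite mulr_ge0 ?powR_ge0// ltW.
apply: (powR_absorb p0 q0 pq X0); first by rewrite mulr_ge0 ?powR_ge0// ltW.
apply: (@le_trans _ _ (q * \sum_(k < N) v k * (b k * A k `^ (p - 1)))).
  apply: (@le_trans _ _ (\sum_(k < N) (q * (v k * (b k * A k `^ (p - 1)))
      + (q - 1) * (r k.+1 * A k.+1 `^ p - r k * A k `^ p)))).
    by apply: ler_sum => k _; exact: step.
  rewrite big_split/= -!mulr_sumr.
  rewrite -(big_mkord xpredT (fun k => r k.+1 * A k.+1 `^ p - r k * A k `^ p)).
  (* Only boundary terms remain: the one at [N] has [r N = 0], and the one at [0] enters with a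
     nonpositive sign. *)
  rewrite (telescope_sumr (fun k => r k * A k `^ p))// gerDl.
  rewrite mulr_ge0_le0 ?subr_ge0 ?(ltW q1)// /(r N) big_geq// mul0r sub0r oppr_le0.
  by rewrite mulr_ge0 ?powR_ge0.
rewrite -mulrA ler_pM2l//.
have := @hoelder_sum R 'I_N p q v b (fun k => A k `^ (p - 1)) p0 q0 pq
  (fun k => ltW (v0 k)) b0 (fun k => powR_ge0 _ _).
by under [X in _ <= _ * X `^ _]eq_bigr do rewrite (conjugate_powRB1 _ p0 q0 pq).
Qed.

(** The kernel is split into [k <= j] and [j <= k], the diagonal being counted twice. One half pairs
    [c] with the tail mean of [b], at cost [q]; the other pairs [b] with that of [c], at cost
    [p]. *)
Lemma hardy_bilinear (R : realType) (p q : R) (N : nat) (v b c : nat -> R) :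
  0 < p -> 0 < q -> p^-1 + q^-1 = 1 ->
  (forall k, 0 < v k) -> (forall k, 0 <= b k) -> (forall k, 0 <= c k) ->
  \sum_(k < N) \sum_(j < N)
    v k * v j * c k * b j / \sum_(minn k j <= i < N) v i
  <= (p + q) * ((\sum_(k < N) v k * b k `^ p) `^ p^-1 *
                (\sum_(k < N) v k * c k `^ q) `^ q^-1).
Proof.
move=> p0 q0 pq v0 b0 c0.
have qp : q^-1 + p^-1 = 1 by rewrite addrC.
pose r k := \sum_(k <= j < N) v j.
pose Hb k := (\sum_(k <= j < N) v j * b j) / r k.
pose Hc k := (\sum_(k <= j < N) v j * c j) / r k.
have r0 k : 0 <= r k by apply: sumr_ge0 => i _; exact: ltW.
have Hb0 k : 0 <= Hb k.
  by rewrite divr_ge0// sumr_ge0 // => i _; rewrite mulr_ge0// ltW.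
have Hc0 k : 0 <= Hc k.
  by rewrite divr_ge0// sumr_ge0 // => i _; rewrite mulr_ge0// ltW.
have tail (f : nat -> R) (k : 'I_N) :
    \sum_(k <= j < N) f j = \sum_(j < N | (k <= j)%N) f j.
  by rewrite (big_nat_widenl _ 0%N)// big_mkord.
apply: (@le_trans _ _ (\sum_(k < N) v k * (Hb k * c k)
                       + \sum_(k < N) v k * (b k * Hc k))).
  apply: (@le_trans _ _ (\sum_(k < N) \sum_(j < N | (k <= j)%N)
        v k * v j * c k * b j / r k
      + \sum_(k < N) \sum_(j < N | (j <= k)%N) v k * v j * c k * b j / r j)).
    rewrite -big_split/=; apply: ler_sum => k _.
    rewrite [in leRHS]big_mkcond [X in _ <= _ + X]big_mkcond -big_split/=.
    apply: ler_sum => j _; rewrite /minn.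
    have T0 i : 0 <= v k * v j * c k * b j / r i.
      by rewrite !mulr_ge0 ?invr_ge0// ltW.
    case: (ltnP k j) => kj; first by rewrite (ltnW kj) addr0.
    by case: ifP => _; rewrite ?add0r// lerDr T0.
  rewrite lerD//.
    apply: ler_sum => k _; rewrite /Hb tail mulr_suml mulr_suml mulr_sumr.
    by apply: ler_sum => j _; rewrite le_eqVlt; apply/orP; left; apply/eqP; ring.
  rewrite (exchange_big_dep xpredT)//=.
  apply: ler_sum => j _; rewrite /Hc tail mulr_suml !mulr_sumr.
  by apply: ler_sum => k _; rewrite le_eqVlt; apply/orP; left; apply/eqP; ring.
set B := (\sum_(k < N) v k * b k `^ p) `^ p^-1.
set C := (\sum_(k < N) v k * c k `^ q) `^ q^-1.
have v0' (k : 'I_N) : 0 <= v k by rewrite ltW.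
rewrite addrC mulrDl; apply: lerD.
  apply: (le_trans (hoelder_sum p0 q0 pq v0' (fun k : 'I_N => b0 k)
                               (fun k : 'I_N => Hc0 k))).
  by rewrite mulrCA ler_wpM2l ?powR_ge0// hardy.
apply: (le_trans (hoelder_sum p0 q0 pq v0' (fun k : 'I_N => Hb0 k)
                             (fun k : 'I_N => c0 k))).
by rewrite mulrA ler_wpM2r ?powR_ge0// hardy.
Qed.

(** * Multiscale averages *)

Lemma abel_bound (R : realType) (rho e : nat -> R) (m : nat) (B : R) :
  0 <= rho 0%N -> (forall l, (l < m)%N -> rho l <= rho l.+1) ->
  (forall l, `|e l| <= B) ->
  `|\sum_(l < m.+1) rho l * (e l.+1 - e l)| <= 2 * rho m * B.
Proof.
move=> rho0 rhoS eB.
have rho_ge0 : 0 <= rho m.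
  elim: m rhoS => // m IH rhoS; apply: le_trans (rhoS m (leqnn _)).
  by apply: IH => l lm; apply: rhoS; exact: ltnW.
(* Summation by parts: the remainder is [rho 0 * e 0] plus the increments of [rho] against [e], with
   nonnegative weights adding up to [rho m]. *)
have H : `|rho m * e m.+1 - \sum_(l < m.+1) rho l * (e l.+1 - e l)| <= rho m * B.
  elim: m rhoS {rho_ge0} => [_|m IH rhoS].
    rewrite big_ord_recl big_ord0 addr0 -mulrBr opprB addrCA subrr addr0 normrM.
    by rewrite ger0_norm// ler_wpM2l.
  have {}IH := IH (fun l lm => rhoS l (ltnW lm)).
  rewrite big_ord_recr/=.
  set S := \sum_(l < m.+1) _ in IH *.
  have -> : rho m.+1 * e m.+2 - (S + rho m.+1 * (e m.+2 - e m.+1))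
          = (rho m.+1 - rho m) * e m.+1 + (rho m * e m.+1 - S) by ring.
  apply: (le_trans (ler_normD _ _)).
  have -> : rho m.+1 * B = (rho m.+1 - rho m) * B + rho m * B by ring.
  rewrite lerD// normrM ger0_norm ?subr_ge0 ?rhoS//.
  by rewrite ler_wpM2l ?subr_ge0 ?rhoS.
have H2 : `|rho m * e m.+1| <= rho m * B.
  by rewrite normrM ger0_norm// ler_wpM2l.
move: H H2; rewrite !ler_norml => /andP[H1 H2] /andP[H3 H4].
by apply/andP; split; lra.
Qed.

(** Hölder's inequality on pairs of indices with weight [K]; each norm sees one coordinate only,
    hence the marginal [mu]. *)
Lemma coupling_bound (R : realType) (I : finType) (p q : R) (mu : I -> R)
    (K : I -> I -> R) (F G : I -> R) :
  0 < p -> 0 < q -> p^-1 + q^-1 = 1 -> (forall i j, 0 <= K i j) ->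
  (forall i, \sum_j K i j = mu i) -> (forall j, \sum_i K i j = mu j) ->
  `|\sum_i \sum_j K i j * (G i * F j)| <=
  (\sum_i mu i * `|F i| `^ p) `^ p^-1 * (\sum_i mu i * `|G i| `^ q) `^ q^-1.
Proof.
move=> p0 q0 pq K0 Kl Kr.
have := @hoelder_sum R (I * I)%type p q (fun u => K u.1 u.2)
  (fun u => `|F u.2|) (fun u => `|G u.1|) p0 q0 pq (fun u => K0 _ _)
  (fun u => normr_ge0 _) (fun u => normr_ge0 _).
rewrite -(pair_bigA _ (fun i j => K i j * (`|F j| * `|G i|)))/=.
rewrite -(pair_bigA _ (fun i j => K i j * `|F j| `^ p))/=.
rewrite -(pair_bigA _ (fun i j => K i j * `|G i| `^ q))/=.
rewrite [X in X `^ p^-1]exchange_big/=.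
under [X in _ <= X `^ _ * _ -> _]eq_bigr do rewrite -mulr_suml Kr.
under [X in _ <= _ * X `^ _ -> _]eq_bigr do rewrite -mulr_suml Kl.
apply: le_trans; apply: (le_trans (ler_norm_sum _ _ _)); apply: ler_sum => i _.
apply: (le_trans (ler_norm_sum _ _ _)); apply: ler_sum => j _.
by rewrite normrM ger0_norm// normrM [`|G i| * _]mulrC.
Qed.

(* The pairing of [H] with its dual function [G] splits over the pairs of
   levels; each pair is an Abel sum of couplings, which the level norms of [F]
   and [G] control, and Hardy's inequality sums over the levels. *)
Lemma multiscale_bound (R : realType) (I : finType) (p q : R) (N : nat)
    (w : nat -> R) (mu : I -> R) (K : nat -> I -> I -> R) (F H : nat -> I -> R) :
  0 < p -> 0 < q -> p^-1 + q^-1 = 1 -> (forall k, 0 < w k) ->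
  (forall l i j, 0 <= K l i j) ->
  (forall l i, \sum_j K l i j = mu i) -> (forall l j, \sum_i K l i j = mu j) ->
  (forall k i, (k < N)%N -> mu i * H k i = w k `^ (1 - q) *
     \sum_(j < N) \sum_(l < (minn k j).+1)
       (\sum_(l <= m < N) w m `^ (1 - q))^-1 *
       \sum_i' (K l.+1 i i' - K l i i') * F j i') ->
  (\sum_(k < N) w k * \sum_i mu i * `|H k i| `^ p) `^ p^-1 <=
  2 * (p + q) * (\sum_(k < N) w k * \sum_i mu i * `|F k i| `^ p) `^ p^-1.
Proof.
move=> p0 q0 pq w0 K0 Kl Kr HE.
pose v k := w k `^ (1 - q).
pose r k := \sum_(k <= j < N) v j.
have v0 k : 0 < v k by apply: powR_gt0.
have mu0 i : 0 <= mu i by rewrite -(Kl 0%N); apply: sumr_ge0.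
have p1 : 1 < p := conjugate_ge1 p0 q0 pq.
(* Conjugacy gives [(1 - q) * (1 - p) = 1], so dividing by [v] turns an L^p norm of weight [w] into
   one of weight [v]. *)
have wp k : v k * (v k)^-1 `^ p = w k.
  rewrite -[(v k)^-1]powR_inv1 ?ltW// -!powRrM -powRD; last first.
    by rewrite (gt_eqF (w0 k)) implybT.
  have -> : 1 - q + (1 - q) * (-1 * p) = 1.
    have := conjugate_mul p0 q0 pq; lra.
  by rewrite powRr1// ltW.
have wq k : v k * w k `^ q = w k.
  rewrite -powRD; last by rewrite (gt_eqF (w0 k)) implybT.
  by rewrite subrK powRr1// ltW.
(* The extremal function for [H k] in Hölder's inequality. *)
pose G k i := Num.sg (H k i) * `|H k i| `^ (p - 1).
have HG k i : H k i * G k i = `|H k i| `^ p.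
  by rewrite mulrA [_ * Num.sg _]mulrC -normrEsg mulr_powRB1.
have Gq k i : `|G k i| `^ q = `|H k i| `^ p.
  rewrite normrM (ger0_norm (powR_ge0 _ _)) normr_sg.
  have [->|_] := eqVneq (H k i) 0; last first.
    by rewrite mul1r (conjugate_powRB1 _ p0 q0 pq).
  by rewrite mul0r normr0 !powR0// gt_eqF.
pose b k := (\sum_i mu i * `|F k i| `^ p) `^ p^-1.
pose c k := (\sum_i mu i * `|G k i| `^ q) `^ q^-1.
set X := \sum_(k < N) w k * \sum_i mu i * `|H k i| `^ p.
have X0 : 0 <= X.
  apply: sumr_ge0 => k _; rewrite mulr_ge0 ?(ltW (w0 _))// sumr_ge0// => i _.
  by rewrite mulr_ge0 ?powR_ge0.
have pq0 : 0 <= p + q by rewrite addr_ge0// ltW.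
apply: (powR_absorb p0 q0 pq X0).
  by rewrite !mulr_ge0 ?powR_ge0.
have rle k j : (k <= j)%N -> (j < N)%N -> r j <= r k.
  move=> kj jN; rewrite /r (big_cat_nat kj (ltnW jN))/= lerDr.
  by apply: sumr_ge0 => i _; exact: ltW.
have rp k : (k < N)%N -> 0 < r k.
  move=> kN; rewrite /r big_ltn// ltr_wpDr// sumr_ge0// => i _; exact: ltW.
(* The pairing of [G k] with the average of [F j] at scale [l]; its bound is uniform in [l], as Abel
   summation requires. *)
pose e k j l := \sum_i \sum_i' K l i i' * (G k i * F j i').
have eB k j l : `|e k j l| <= b j * c k.
  exact: (coupling_bound _ _ p0 q0 pq (K0 l) (Kl l) (Kr l)).
have XE : X = \sum_(k < N) \sum_(j < N) w k * v k *
    \sum_(l < (minn k j).+1) (r l)^-1 * (e k j l.+1 - e k j l).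
  apply: eq_bigr => k _; rewrite -mulr_sumr -mulrA; congr (_ * _).
  under eq_bigr do rewrite -HG mulrA HE// -mulrA.
  rewrite -mulr_sumr; congr (_ * _).
  under eq_bigr do rewrite mulr_suml.
  rewrite exchange_big/=; apply: eq_bigr => j _.
  under eq_bigr do rewrite mulr_suml.
  rewrite exchange_big/=; apply: eq_bigr => l _.
  under eq_bigr do rewrite -mulrA.
  rewrite -mulr_sumr; congr (_ * _).
  rewrite -sumrB; apply: eq_bigr => i _; rewrite -sumrB mulr_suml.
  by apply: eq_bigr => i' _; ring.
(* The factors are grouped for [hardy_bilinear] with weight [v]: the norm of [(v j)^-1 * b j] is
   that of [F], and the norm of [w k * c k] is [X ^ (1/q)]. *)
have XB : X <= 2 * \sum_(k < N) \sum_(j < N)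
    v k * v j * (w k * c k) * ((v j)^-1 * b j) / r (minn k j).
  rewrite {1}XE mulr_sumr; apply: ler_sum => k _.
  rewrite mulr_sumr; apply: ler_sum => j _.
  have mN : (minn k j < N)%N by rewrite (leq_ltn_trans (geq_minl _ _)).
  have vj : v j != 0 by rewrite gt_eqF.
  apply: (@le_trans _ _ (w k * v k * (2 * (r (minn k j))^-1 * (b j * c k)))).
    rewrite ler_wpM2l//; first by rewrite mulr_ge0// ltW.
    apply: le_trans (ler_norm _) _.
    apply: (@abel_bound R (fun l => (r l)^-1)) => //.
      by rewrite invr_ge0 ltW// rp// (leq_ltn_trans _ mN).
    move=> l lm; have lN := leq_ltn_trans lm mN.
    by rewrite lef_pV2 ?posrE ?rp ?rle// ltnW.
  rewrite le_eqVlt; apply/orP; left; apply/eqP.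
  by field; rewrite vj gt_eqF ?rp.
apply: (le_trans XB); rewrite -!mulrA ler_wpM2l//.
have b0 k : 0 <= b k by apply: powR_ge0.
have c0 k : 0 <= c k by apply: powR_ge0.
have := @hardy_bilinear R p q N v (fun k => (v k)^-1 * b k) (fun k => w k * c k)
  p0 q0 pq v0.
have vV k : 0 <= (v k)^-1 by rewrite invr_ge0 ltW.
move=> /(_ (fun k => mulr_ge0 (vV k) (b0 k))
           (fun k => mulr_ge0 (ltW (w0 k)) (c0 k))).
move=> /le_trans; apply; rewrite ler_wpM2l// le_eqVlt; apply/orP; left; apply/eqP.
have S0 (f : I -> R) (s : R) : 0 <= \sum_i mu i * `|f i| `^ s.
  by apply: sumr_ge0 => i _; rewrite mulr_ge0 ?powR_ge0.
congr (_ `^ _ * _ `^ _); apply: eq_bigr => k _.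
  by rewrite powRM// mulrA wp powR_invK// S0.
rewrite powRM ?(ltW (w0 _))// mulrA wq powR_invK ?S0//.
by under eq_bigr do rewrite Gq.
Qed.

(** * Extension from the leaves of the tree *)

Lemma val_prefix_of (N l : nat) (x : vertex N) :
  prefix_of l x = take l x :> seq bool.
Proof. by []. Qed.

Lemma depth_prefix_of (N l : nat) (x : vertex N) : (l <= depth x)%N ->
  depth (prefix_of l x) = l.
Proof. exact: size_takel. Qed.

Lemma prefix_of_prefix (N l k : nat) (x : vertex N) : (l <= k)%N ->
  prefix_of l (prefix_of k x) = prefix_of l x.
Proof. by move=> lk; apply: val_inj; rewrite /= take_takel. Qed.

Lemma prefix_of_oversize (N l : nat) (x : vertex N) : (depth x <= l)%N ->
  prefix_of l x = x.
Proof. by move=> xl; apply: val_inj; rewrite /= take_oversize. Qed.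

(** A leaf below [x] is [x] followed by a free string of the missing length. *)
Lemma card_leaves_below (N : nat) (x : vertex N) :
  #|[pred y : vertex N | leaf y && (prefix_of (depth x) y == x)]|
  = (2 ^ (N - depth x))%N.
Proof.
have sz (t : (N - depth x).-tuple bool) : (size (x ++ t) <= N)%N.
  by rewrite size_cat size_tuple subnKC// size_bseq.
pose h t : vertex N := Bseq (sz t).
have hI : injective h.
  move=> t u /(congr1 val)/= /eqP.
  by rewrite eqseq_cat// eqxx/= => /eqP/val_inj.
rewrite -[in RHS]card_bool -card_tuple -(fintype.card_image hI).
apply: eq_card => y; rewrite inE; apply/idP/fintype.imageP => [/andP[/eqP yN /eqP yx]|].
  have szd : size (drop (depth x) y) == (N - depth x)%N.
    by rewrite size_drop; apply/eqP; congr (_ - _)%N.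
  exists (Tuple szd) => //; apply: val_inj => /=.
  by rewrite -{1}yx val_prefix_of cat_take_drop.
case=> t _ ->; apply/andP; split.
  by rewrite /leaf /depth /= size_cat size_tuple subnKC// size_bseq.
by apply/eqP/val_inj; rewrite /= take_size_cat.
Qed.

(** For [l > N] only the alternative [leaf x] can hold: [x] alone shares its prefix, and truncated
    subtraction gives [2 ^ 0 = 1]. *)
Lemma card_leaves_sharing_prefix (N l : nat) (x : vertex N) :
  (l <= depth x)%N || leaf x ->
  #|[pred y : vertex N | leaf y && (prefix_of l y == prefix_of l x)]|
  = (2 ^ (N - l))%N.
Proof.
have xN : (depth x <= N)%N := size_bseq x.
case: (leqP l (depth x)) => [lx _|xl /= /eqP xE].
  by have := card_leaves_below (prefix_of l x); rewrite depth_prefix_of.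
have -> : (N - l = N - depth x)%N by lia.
rewrite -card_leaves_below; apply: eq_card => y; rewrite !inE.
case: (boolP (leaf y)) => //= /eqP yN.
by rewrite !prefix_of_oversize ?yN ?xE// -?xE ltnW.
Qed.

Lemma sum_leaves_prefix (V : nmodType) (N k : nat) (phi : vertex N -> V) :
  (k <= N)%N ->
  \sum_(y | leaf y) phi (prefix_of k y) =
  \sum_(x | depth x == k) phi x *+ 2 ^ (N - k).
Proof.
move=> kN.
rewrite (partition_big (prefix_of k) (fun x => depth x == k))/=; last first.
  by move=> y /eqP yN; rewrite depth_prefix_of// yN.
apply: eq_bigr => x /eqP xk.
rewrite (eq_bigr (fun=> phi x)); last by move=> y /andP[_ /eqP->].
by rewrite sumr_const -xk card_leaves_below.
Qed.

(** The operator [A_l]: for [l <= depth x], the conditional expectation of [g] at a uniform leaf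
    given its first [l] letters. *)
Definition leaf_mean (R : realType) (N l : nat) (g : vertex N -> R)
    (x : vertex N) : R :=
  (2 ^+ (N - l))^-1 * \sum_(y | leaf y && (prefix_of l y == prefix_of l x)) g y.

Lemma leaf_mean_const (R : realType) (N l : nat) (g : vertex N -> R)
    (x : vertex N) (a : R) :
  (l <= depth x)%N || leaf x ->
  (forall y, leaf y -> prefix_of l y = prefix_of l x -> g y = a) ->
  leaf_mean l g x = a.
Proof.
move=> lx ga; rewrite /leaf_mean (eq_bigr (fun=> a)); last first.
  by move=> y /andP[yl /eqP yx]; exact: ga.
rewrite sumr_const card_leaves_sharing_prefix// -[a *+ _]mulr_natl natrX mulKf//.
Qed.

Lemma leaf_mean_prefix (R : realType) (N l k : nat) (g : vertex N -> R)
    (x : vertex N) :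
  (l <= k)%N -> leaf_mean l g (prefix_of k x) = leaf_mean l g x.
Proof. by move=> lk; rewrite /leaf_mean prefix_of_prefix. Qed.

Lemma eq_leaf_mean (R : realType) (N l : nat) (g1 g2 : vertex N -> R) x :
  (forall y, leaf y -> g1 y = g2 y) -> leaf_mean l g1 x = leaf_mean l g2 x.
Proof.
by move=> gg; congr (_ * _); apply: eq_bigr => y /andP[yl _]; exact: gg.
Qed.

Lemma leaf_mean_sum (R : realType) (N l : nat) (J : finType)
    (g : J -> vertex N -> R) x :
  leaf_mean l (fun y => \sum_j g j y) x = \sum_j leaf_mean l (g j) x.
Proof. by rewrite /leaf_mean exchange_big mulr_sumr. Qed.

Lemma leaf_mean_linear (R : realType) (N l : nat) (a : R)
    (g h : vertex N -> R) x :
  leaf_mean l (fun y => a * g y + h y) x =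
  a * leaf_mean l g x + leaf_mean l h x.
Proof. by rewrite /leaf_mean big_split/= -mulr_sumr; ring. Qed.

(* Harmonic extension for the radial random walk that steps from depth [k] to
   depth [k.-1] before being absorbed at a leaf with probability [r k / r k.-1];
   the Abel-summed form used here stays meaningful at the leaves, where
   [r N = 0]. *)
Definition extend_leaves (R : realType) (N : nat) (r : nat -> R)
    (g : {ffun vertex N -> R}) : {ffun vertex N -> R} :=
  [ffun x => leaf_mean (depth x) g x -
     r (depth x) * \sum_(l < depth x)
       (r l)^-1 * (leaf_mean l.+1 g x - leaf_mean l g x)].

Lemma extend_leaves_linear (R : realType) (N : nat) (r : nat -> R) :
  linear (@extend_leaves R N r).
Proof.
move=> a g h; apply/ffunP => x; rewrite !ffunE.
have ml l : leaf_mean l (a *: g + h) x = a * leaf_mean l g x + leaf_mean l h x.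
  by rewrite -leaf_mean_linear; apply: eq_leaf_mean => y _; rewrite !ffunE.
rewrite ml; under eq_bigr do rewrite !ml.
set S := \sum_(l < _) _.
have -> : S = a * \sum_(l < depth x) (r l)^-1 * (leaf_mean l.+1 g x - leaf_mean l g x)
   + \sum_(l < depth x) (r l)^-1 * (leaf_mean l.+1 h x - leaf_mean l h x).
  by rewrite mulr_sumr -big_split/=; apply: eq_bigr => l _; ring.
have scE (u : R) : a *: u = a * u by [].
by rewrite scE; ring.
Qed.

HB.instance Definition _ (R : realType) (N : nat) (r : nat -> R) :=
  GRing.isLinear.Build R {ffun vertex N -> R} {ffun vertex N -> R} _
    (@extend_leaves R N r) (extend_leaves_linear r).

(** The last term of the sum at [x], multiplied by [r k], is exactly the change of mean from the
    parent to [x], so everything merges into one sum. *)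
Lemma extend_leaves_diff (R : realType) (N k : nat) (r : nat -> R)
    (g : {ffun vertex N -> R}) (x : vertex N) :
  depth x = k.+1 -> r k != 0 ->
  extend_leaves r g x - extend_leaves r g (parent x) =
  (r k - r k.+1) *
    \sum_(l < k.+1) (r l)^-1 * (leaf_mean l.+1 g x - leaf_mean l g x).
Proof.
move=> xk rk; rewrite !ffunE /parent xk/= depth_prefix_of ?xk//.
under [X in _ - (_ - _ * X)]eq_bigr do rewrite !leaf_mean_prefix// 1?ltnW//.
by rewrite leaf_mean_prefix// big_ord_recr/=; field.
Qed.

Lemma extend_leaves1 (R : realType) (N : nat) (r : nat -> R) :
  @extend_leaves R N r [ffun=> 1] = [ffun=> 1].
Proof.
apply/ffunP => x; rewrite !ffunE.
have m1 l : (l <= depth x)%N -> leaf_mean l [ffun=> (1 : R)] x = 1.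
  by move=> lx; apply: leaf_mean_const => [|y _ _]; rewrite ?lx// ffunE.
rewrite m1// big1 ?mulr0 ?subr0// => l _.
by rewrite !m1 ?subrr ?mulr0// ltnW.
Qed.

(** [r N = 0] removes the correction, and a leaf is the only leaf with its prefix of length [N]. *)
Lemma extend_leaves_leaf (R : realType) (N : nat) (r : nat -> R) g
    (x : vertex N) :
  r N = 0 -> leaf x -> extend_leaves r g x = g x.
Proof.
move=> rN xl; rewrite ffunE (eqP xl) rN mul0r subr0.
apply: leaf_mean_const => [|y yl]; first by rewrite xl orbT.
by rewrite !prefix_of_oversize ?(eqP yl) ?(eqP xl)// => ->.
Qed.

Lemma extend_leaves_congr (R : realType) (N : nat) (r : nat -> R)
    (g1 g2 : {ffun vertex N -> R}) :
  (forall x, leaf x -> g1 x = g2 x) -> extend_leaves r g1 = extend_leaves r g2.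
Proof.
move=> gg; apply/ffunP => x; rewrite !ffunE (eq_leaf_mean _ _ gg).
by under eq_bigr do rewrite !(eq_leaf_mean _ _ gg).
Qed.

(** Prefixes are iterated parents, so induction on the depth reduces the claim to preservation of
    parenthood. *)
Lemma symmetry_prefix_of (N l : nat) (s : {perm vertex N}) (x : vertex N) :
  symmetry s -> s (prefix_of l x) = prefix_of l (s x).
Proof.
case=> sd sp; have [m xm] := ubnP (depth x); elim: m x xm => // m IH x xm.
case: (leqP (depth x) l) => xl; first by rewrite !prefix_of_oversize ?sd.
have xr : x != root_vertex N by apply: contraTneq xl => ->.
have : is_parent (s (parent x)) (s x) by rewrite sp /is_parent xr eqxx.
move=> /andP[_ /eqP sE].
have lx : (l <= (depth x).-1)%N by lia.
rewrite -(prefix_of_prefix x lx) -/(parent x) IH; last first.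
  by rewrite /parent depth_prefix_of; lia.
by rewrite sE /parent sd prefix_of_prefix.
Qed.

(** The tree enters only through depths and prefixes; a symmetry respects both, so it suffices to
    reindex the leaves in each mean. *)
Lemma extend_leaves_equivariant (R : realType) (N : nat) (r : nat -> R) :
  equivariant (@extend_leaves R N r).
Proof.
move=> g s ss; have sd := ss.1; apply/ffunP => x; rewrite !ffunE sd.
have ms l : leaf_mean l [ffun y => g (s y)] x = leaf_mean l g (s x).
  rewrite /leaf_mean [in RHS](reindex_inj (@perm_inj _ s)); congr (_ * _).
  apply: eq_big => [y|y _]; last by rewrite ffunE.
  by rewrite /leaf sd -!symmetry_prefix_of// (inj_eq perm_inj).
by rewrite ms; under eq_bigr do rewrite !ms.
Qed.

(** * The operator on edge functions *)

(** The value [0] at the root allows edges to be read off as prefixes of leaves without carrying a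
    proof that they are not the root. *)
Definition edge_ext (R : realType) (N : nat) (f : {ffun edge N -> R})
    (x : vertex N) : R :=
  oapp f 0 (insub x).

Lemma edge_ext_val (R : realType) (N : nat) (f : {ffun edge N -> R})
    (x : edge N) : edge_ext f (val x) = f x.
Proof. by rewrite /edge_ext valK. Qed.

Lemma tilde_leaf (R : realType) (N : nat) (f : {ffun edge N -> R}) y :
  leaf y -> tilde f y = \sum_(j < N) edge_ext f (prefix_of j.+1 y).
Proof.
move=> /eqP yN; rewrite ffunE.
rewrite -(big_mkord xpredT (fun j => edge_ext f (prefix_of j.+1 y))).
rewrite -[X in \sum_(_ <= _ < X) _]yN big_mkord; apply: eq_bigr => i _.
exact/esym/(edge_ext_val f (prefix_edge i)).
Qed.

Lemma tilde_linear (R : realType) (N : nat) (a : R) (f g : {ffun edge N -> R}) :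
  tilde (a *: f + g) = a *: tilde f + tilde g.
Proof.
apply/ffunP => x; rewrite !ffunE scaler_sumr -big_split.
by apply: eq_bigr => i _; rewrite !ffunE.
Qed.

Definition edge_operator (R : realType) (N : nat) (r : nat -> R)
    (f : {ffun edge N -> R}) : {ffun edge N -> R} :=
  [ffun x => extend_leaves r (tilde f) (val x)
             - extend_leaves r (tilde f) (parent (val x))].

Lemma edge_operator_linear (R : realType) (N : nat) (r : nat -> R) :
  linear (@edge_operator R N r).
Proof.
move=> a f g; apply/ffunP => x.
by rewrite ffunE tilde_linear linearP !ffunE opprD addrACA -scalerBr.
Qed.

HB.instance Definition _ (R : realType) (N : nat) (r : nat -> R) :=
  GRing.isLinear.Build R {ffun edge N -> R} {ffun edge N -> R} _
    (@edge_operator R N r) (edge_operator_linear r).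

(** * Couplings of leaves and the norm bound *)

(** Joint law of a uniform leaf [x] and a leaf [y] uniform among those sharing its first [l]
    letters: the kernel of [A_l] against the uniform measure. The indicator extends it by zero to
    all vertices. *)
Definition leaf_coupling (R : realType) (N l : nat) (x y : vertex N) : R :=
  [&& leaf x, leaf y & prefix_of l y == prefix_of l x]%:R
    / 2 ^+ N / 2 ^+ (N - l).

Lemma leaf_coupling_ge0 (R : realType) (N l : nat) (x y : vertex N) :
  0 <= leaf_coupling R l x y.
Proof. by rewrite !mulr_ge0 ?invr_ge0 ?exprn_ge0. Qed.

Lemma leaf_couplingC (R : realType) (N l : nat) (x y : vertex N) :
  leaf_coupling R l x y = leaf_coupling R l y x.
Proof. by rewrite /leaf_coupling andbCA eq_sym. Qed.

Lemma sum_leaf_coupling (R : realType) (N l : nat) (g : vertex N -> R)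
    (x : vertex N) :
  \sum_y leaf_coupling R l x y * g y = (leaf x)%:R / 2 ^+ N * leaf_mean l g x.
Proof.
rewrite /leaf_mean [in RHS]big_mkcond !mulr_sumr; apply: eq_bigr => y _.
rewrite /leaf_coupling; case: (leaf x) => /=; last by rewrite !mul0r.
by case: ifP => _; rewrite ?mul0r ?mulr0// !mulrA.
Qed.

Lemma leaf_coupling_marginal (R : realType) (N l : nat) (x : vertex N) :
  \sum_y leaf_coupling R l x y = (leaf x)%:R / 2 ^+ N.
Proof.
transitivity (\sum_y leaf_coupling R l x y * 1).
  by apply: eq_bigr => y _; rewrite mulr1.
rewrite (sum_leaf_coupling _ (fun=> 1)).
case: (boolP (leaf x)) => xl; last by rewrite !mul0r.
by rewrite (@leaf_mean_const _ _ _ _ _ 1) ?mulr1// xl orbT.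
Qed.

(** All levels are moved to the uniform measure on leaves; [w] carries the number [2 ^ (k+1)] of
    edges of depth [k.+1]. *)
Lemma lp_norm_leaves (R : realType) (N : nat) (p : R) (W : 'I_N -> R)
    (w : nat -> R) (f : {ffun edge N -> R}) :
  (forall k : 'I_N, w k = W k * 2 ^+ k.+1) ->
  lp_norm p W f = (\sum_(k < N) w k * \sum_x (leaf x)%:R / 2 ^+ N *
     `|edge_ext f (prefix_of k.+1 x)| `^ p) `^ p^-1.
Proof.
move=> wW; congr (_ `^ _); apply: eq_bigr => k _; rewrite wW -mulrA.
congr (_ * _).
pose phi x := `|edge_ext f x| `^ p.
have -> : \sum_(x : edge N | depth (val x) == k.+1) `|f x| `^ p
        = \sum_(x : vertex N | depth x == k.+1) phi x.
  rewrite (bigID (fun x => x != root_vertex N))/= [X in _ + X]big1 ?addr0.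
    rewrite (eq_bigl (fun x => (x != root_vertex N) && (depth x == k.+1))).
      rewrite (big_sub_cond (fun x => x != root_vertex N)
                            (fun x => depth x == k.+1) phi)/=.
      by apply: eq_bigr => x _; rewrite /phi edge_ext_val.
    by move=> x; rewrite andbC.
  by move=> x /andP[/eqP xk /negPn/eqP x0]; rewrite x0 in xk.
have -> : \sum_x (leaf x)%:R / 2 ^+ N * `|edge_ext f (prefix_of k.+1 x)| `^ p
        = (2 ^+ N)^-1 * \sum_(x | leaf x) phi (prefix_of k.+1 x).
  rewrite mulr_sumr [RHS]big_mkcond; apply: eq_bigr => x _.
  by case: (leaf x); rewrite ?mul1r// !mul0r.
rewrite sum_leaves_prefix// sumrMnl; set S := \sum_(x | _) _.
rewrite -[S *+ _]mulr_natl natrX !mulrA [_ / _ * _]mulrAC -exprD subnKC//.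
by rewrite divff ?mul1r// expf_neq0 ?pnatr_eq0.
Qed.

(** Level [j] depends on the first [j.+1] letters only, so its mean increments vanish for [l > j];
    hence the truncation at [minn k j]. *)
Lemma edge_operator_leaves (R : realType) (N k : nat) (v : nat -> R)
    (f : {ffun edge N -> R}) (x : vertex N) :
  let r l := \sum_(l <= m < N) v m in
  (forall l, 0 < v l) -> (k < N)%N -> leaf x ->
  edge_ext (edge_operator r f) (prefix_of k.+1 x) =
  v k * \sum_(j < N) \sum_(l < (minn k j).+1) (r l)^-1 *
    (leaf_mean l.+1 (fun y => edge_ext f (prefix_of j.+1 y)) x
     - leaf_mean l (fun y => edge_ext f (prefix_of j.+1 y)) x).
Proof.
move=> r v0 kN xl; set z := prefix_of k.+1 x.
have zk : depth z = k.+1 by rewrite depth_prefix_of// (eqP xl).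
have z0 : z != root_vertex N by apply: contra_eq_neq zk => ->.
have rS : r k = v k + r k.+1 by rewrite /r big_ltn.
have rk : r k != 0.
  rewrite rS gt_eqF// ltr_wpDr// sumr_ge0// => i _; exact: ltW.
have -> : edge_ext (edge_operator r f) z = edge_operator r f (exist _ z z0).
  exact: (edge_ext_val _ (exist _ z z0)).
rewrite ffunE/= (extend_leaves_diff _ zk rk) rS addrK; congr (_ * _).
pose F j y := edge_ext f (@prefix_of N j.+1 y).
have mF l : leaf_mean l (tilde f) x = \sum_(j < N) leaf_mean l (F j) x.
  by rewrite -leaf_mean_sum; apply: eq_leaf_mean => y; exact: tilde_leaf.
have Fc l j : (j < l)%N -> leaf_mean l (F j) x = F j x.
  move=> jl; apply: leaf_mean_const; first by rewrite xl orbT.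
  by move=> y _ yx; rewrite /F -(prefix_of_prefix y jl) yx prefix_of_prefix.
transitivity (\sum_(l < k.+1) \sum_(j < N)
    (r l)^-1 * (leaf_mean l.+1 (F j) x - leaf_mean l (F j) x)).
  apply: eq_bigr => l _; rewrite !leaf_mean_prefix// 1?ltnW//.
  by rewrite !mF -sumrB mulr_sumr.
rewrite exchange_big; apply: eq_bigr => j _.
(* The truncated sum becomes a conditional sum over [l <= k], whose excluded terms all have
   [j < l]. *)
rewrite [RHS](big_ord_widen k.+1
  (fun l => (r l)^-1 * (leaf_mean l.+1 (F j) x - leaf_mean l (F j) x))); last by lia.
rewrite [RHS]big_mkcond; apply: eq_bigr => l _; case: ifP => // lkj.
rewrite !Fc ?subrr ?mulr0//; have := ltn_ord l; lia.
Qed.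

Lemma edge_operator_bound (R : realType) (N : nat) (p q : R) (W : 'I_N -> R)
    (w : nat -> R) (f : {ffun edge N -> R}) :
  0 < p -> 0 < q -> p^-1 + q^-1 = 1 ->
  (forall k, 0 < w k) -> (forall k : 'I_N, w k = W k * 2 ^+ k.+1) ->
  lp_norm p W (edge_operator (fun l => \sum_(l <= m < N) w m `^ (1 - q)) f)
  <= 2 * (p + q) * lp_norm p W f.
Proof.
move=> p0 q0 pq w0 wW; rewrite !(lp_norm_leaves _ _ wW).
pose r l := \sum_(l <= m < N) w m `^ (1 - q); rewrite -/r.
apply: (@multiscale_bound R (vertex N) p q N w
  (fun x => (leaf x)%:R / 2 ^+ N) (fun l => @leaf_coupling R N l)
  (fun j x => edge_ext f (prefix_of j.+1 x))
  (fun k x => edge_ext (edge_operator r f) (prefix_of k.+1 x))) => //.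
- by move=> l x y; exact: leaf_coupling_ge0.
- by move=> l x; exact: leaf_coupling_marginal.
- move=> l y; rewrite -(leaf_coupling_marginal R l).
  by apply: eq_bigr => x _; exact: leaf_couplingC.
move=> k x kN.
(* Off the leaves both the measure and the couplings vanish. *)
have [xl|xl] := boolP (leaf x); last first.
  rewrite !mul0r big1 ?mulr0// => j _; rewrite big1// => l _.
  rewrite [X in _ * X]big1 ?mulr0// => y _.
  by rewrite /leaf_coupling (negbTE xl) /= !mul0r subrr mul0r.
rewrite (edge_operator_leaves f _ kN xl); last by move=> l; exact: powR_gt0.
rewrite mulrCA; congr (_ * _); rewrite mulr_sumr; apply: eq_bigr => j _.
rewrite mulr_sumr; apply: eq_bigr => l _; rewrite mulrCA; congr (_ * _).
under [RHS]eq_bigr do rewrite mulrBl.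
by rewrite sumrB !sum_leaf_coupling xl mulrBr.
Qed.

(** * Comparison of the constants *)

(** Substituting [q = p / (p - 1)] in [q ^ (1/q)] collects total exponent [1] on [p] and [-1] on
    [p - 1]. *)
Lemma conjugate_const (R : realType) (p q : R) :
  0 < p -> 0 < q -> p^-1 + q^-1 = 1 ->
  p `^ p^-1 * q `^ q^-1 * (p - 1) `^ (- p^-1) = q.
Proof.
move=> p0 q0 pq.
have p1 := conjugate_ge1 p0 q0 pq.
have pm : 0 < p - 1 by rewrite subr_gt0.
have qE : q = p / (p - 1).
  apply: (mulIf (lt0r_neq0 pm)); rewrite divfK ?gt_eqF//.
  by have := conjugate_mul p0 q0 pq; lra.
rewrite {1 3}qE powRM ?invr_ge0 ?ltW//.
rewrite -[(p - 1)^-1]powR_inv1 ?ltW// -powRrM mulN1r.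
rewrite mulrA -powRD ?pq ?oner_eq0// powRr1 ?ltW// -mulrA -powRD.
  by rewrite -opprD [q^-1 + _]addrC pq powR_inv1 ?ltW.
by rewrite (gt_eqF pm) implybT.
Qed.

(** The left side is a geometric mean of [p] and [q] whose weights sum to [1]. *)
Lemma conjugate_const_le_max (R : realType) (p q : R) :
  0 < p -> 0 < q -> p^-1 + q^-1 = 1 ->
  p `^ p^-1 * q `^ q^-1 <= Num.max p q.
Proof.
move=> p0 q0 pq; set M := Num.max p q.
have M0 : 0 < M by rewrite lt_max p0.
rewrite -[leRHS]powRr1 ?(ltW M0)// -pq powRD ?pq ?oner_eq0//.
apply: ler_pM; rewrite ?powR_ge0// ge0_ler_powR ?nnegrE ?invr_ge0 ?(ltW p0)
  ?(ltW q0) ?(ltW M0)// /M le_max lexx ?orbT//.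
Qed.

Theorem theorem1p2 (R : realType) :
  exists C : R, 0 < C /\
  forall p : R, 1 < p ->
  let q := p / (p - 1) in
  exists Cp : R,
    [/\ Cp <= 4 * p `^ p^-1 * q `^ q^-1 *
              (1 + Num.max ((p - 1) `^ (- p^-1)) ((q - 1) `^ (- q^-1))),
        4 * p `^ p^-1 * q `^ q^-1 *
          (1 + Num.max ((p - 1) `^ (- p^-1)) ((q - 1) `^ (- q^-1)))
          <= C * Num.max (p - 1)^-1 (q - 1)^-1
      & forall (N : nat) (W : 'I_N -> R), (1 <= N)%N -> (forall k, 0 < W k) ->
        exists T : {linear {ffun edge N -> R} -> {ffun edge N -> R}},
          (lp_op_norm p W T <= Cp%:E)%E /\
          exists Tt : {linear {ffun vertex N -> R} -> {ffun vertex N -> R}},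
            [/\ forall (f : {ffun edge N -> R}) (x : edge N),
                  T f x = Tt (tilde f) (val x) - Tt (tilde f) (parent (val x)),
                equivariant Tt,
                Tt [ffun=> 1] = [ffun=> 1],
                forall (g : {ffun vertex N -> R}) (x : vertex N),
                  leaf x -> Tt g x = g x
              & forall g1 g2 : {ffun vertex N -> R},
                  (forall x, leaf x -> g1 x = g2 x) -> Tt g1 = Tt g2]].
Proof.
(* With [M] the maximum of [p] and [q], the middle bound is at most [8 * M], and [M >= 2] gives
   [M <= 2 * (M - 1)]. Since [(p - 1)^-1 = q - 1] and [(q - 1)^-1 = p - 1], the constant 16
   suffices. *)
exists 16; split => // p p1 q.
have p0 : 0 < p by rewrite (lt_trans _ p1).
have pm : 0 < p - 1 by rewrite subr_gt0.
have q0 : 0 < q by rewrite divr_gt0.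
have pq : p^-1 + q^-1 = 1.
  by rewrite /q; field; rewrite !gt_eqF.
have qp : q^-1 + p^-1 = 1 by rewrite addrC.
have q1 := conjugate_ge1 q0 p0 qp.
(* The constant of [edge_operator_bound]; it is at most four times the maximum of [p] and [q], which
   is one summand of the stated bound. *)
clearbody q; exists (2 * (p + q)).
set P := p `^ p^-1 * q `^ q^-1.
have P0 : 0 <= P by rewrite mulr_ge0 ?powR_ge0.
have PM : 4 * p `^ p^-1 * q `^ q^-1 *
    (1 + Num.max ((p - 1) `^ (- p^-1)) ((q - 1) `^ (- q^-1)))
    = 4 * (P + Num.max q p).
  rewrite -(mulrA 4) -/P -mulrA mulrDr mulr1 maxr_pMr// conjugate_const//.
  by rewrite /P [p `^ _ * _]mulrC conjugate_const.
have mul_pq := conjugate_mul p0 q0 pq.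
split.
- rewrite PM.
  have pM : p <= Num.max q p by rewrite le_max lexx orbT.
  have qM : q <= Num.max q p by rewrite le_max lexx.
  lra.
- rewrite PM.
  have -> : (p - 1)^-1 = q - 1.
    by apply: (mulIf (lt0r_neq0 pm)); rewrite mulVf ?gt_eqF//; lra.
  have -> : (q - 1)^-1 = p - 1.
    have qm : q - 1 != 0 by rewrite gt_eqF// subr_gt0.
    by apply: (mulIf qm); rewrite mulVf//; lra.
  have -> : Num.max (q - 1) (p - 1) = Num.max q p - 1.
    by rewrite /Order.max ltrD2r; case: ifP.
  have := conjugate_const_le_max p0 q0 pq; rewrite -/P maxC.
  (* Since [(p - 1) * (q - 1) = 1], one of the two exponents is at least [2]. *)
  have : 2 <= Num.max q p.
    rewrite le_max; case: (lerP 2 q) => //= q2; nra.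
  lra.
move=> N W N1 W0.
(* The default [1] keeps [w] positive at indices from [N] on, as the lemmas on sequences require. *)
pose w k := oapp W 1 (insub k) * 2 ^+ k.+1.
have w0 k : 0 < w k.
  by rewrite mulr_gt0 ?exprn_gt0//; case: insub => /=.
have wW (k : 'I_N) : w k = W k * 2 ^+ k.+1 by rewrite /w valK.
pose r l := \sum_(l <= m < N) w m `^ (1 - q).
exists (@edge_operator R N r); split.
  apply: ge_ereal_sup => _ [f /= f1 <-]; rewrite lee_fin.
  apply: le_trans (edge_operator_bound _ p0 q0 pq w0 wW) _.
  by rewrite ler_piMr// mulr_ge0// addr_ge0// ltW.
exists (@extend_leaves R N r); split.
- by move=> f x; rewrite ffunE.
- exact: extend_leaves_equivariant.
- exact: extend_leaves1.
- by move=> g x; apply: extend_leaves_leaf; rewrite /r big_geq.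
- exact: extend_leaves_congr.
Qed.
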